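(* Let $p\in(0,1)$ and fix $x,y\in(0,\infty)$ with $y/x<p$ or $y/x>p^{-1}$. Then there exist finite positive constants $c=c(x,y,p)$ and $C=C(x,y,p)$ such that, for all $N\in\mathbb{N}$ with $\lfloor Nx\rfloor\ge1$ and $\lfloor Ny\rfloor\ge1$, $$\mathrm{Var}\big(G_{(1,1),(\lfloor Nx\rfloor,\lfloor Ny\rfloor)}\big)\le CN^2e^{-cN},$$ and in particular this variance tends to $0$ as $N\to\infty$.
   Context: Notation: $e_1=(1,0)$, $e_2=(0,1)$. The environment is $\{\omega_v\}_{v\in\mathbb{N}^2}$, i.i.d. $\mathrm{Ber}(p)$ under $\mathbb{P}$ (no boundary weights). An admissible path from $(1,1)$ to $(m,n)$ (with $m,n\ge1$) is a finite sequence of sites from $(1,1)$ to $(m,n)$ with all steps in $\{e_1,e_2,e_1+e_2\}$; a diagonal step $e_1+e_2$ into a site $v$ collects $\omega_v$, and horizontal and vertical steps collect $0$. $G_{(1,1),(m,n)}$ is the maximum, over all admissible paths from $(1,1)$ to $(m,n)$, of the total collected weight. *)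

(* Defs.v *)
From HB Require Import structures.
From mathcomp Require Import all_boot all_order all_algebra finmap.
From mathcomp Require Import all_classical all_reals all_analysis.

Set Implicit Arguments.
Unset Strict Implicit.
Unset Printing Implicit Defensive.

Import Order.TTheory GRing.Theory Num.Theory.
Import numFieldNormedType.Exports.

Local Open Scope classical_set_scope.
Local Open Scope ring_scope.

Definition mutually_independent {R : realType} {d d' : measure_display}
    {T : measurableType d} {T' : measurableType d'} (P : probability T R)
    {I : choiceType} (D : set I) (X : I -> {RV P >-> T'}) : Prop :=
  forall (J : {fset I}) (B : I -> set T'),
    [set` J] `<=` D -> (forall i, measurable (B i)) ->
    P (\bigcap_(i in [set` J]) (X i @^-1` B i)) =
    (\prod_(i <- J) P (X i @^-1` B i))%E.

Definition iid_bernoulli {R : realType} {d : measure_display}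
    {T : measurableType d} (P : probability T R) (p : R)
    {I : choiceType} (D : set I) (X : I -> {RV P >-> bool}) : Prop :=
  mutually_independent D X /\
  forall i, D i -> distribution P (X i) = bernoulli_prob p :> (set bool -> \bar R).

Definition site : Type := (nat * nat)%type.

Definition positive_sites : set site := [set v | (0 < v.1)%N /\ (0 < v.2)%N].

Definition diagonal_step (u v : site) : bool := v == (u.1.+1, u.2.+1).

Definition admissible_step (u v : site) : bool :=
  [|| v == (u.1.+1, u.2), v == (u.1, u.2.+1) | diagonal_step u v].

(* As in path.v, a path is given by its first site u and the sequence s of the
   sites that follow u. *)
Definition admissible_path (u v : site) : set (seq site) :=
  [set s | path admissible_step u s /\ last u s = v].

Fixpoint path_weight {R : realType} (w : site -> R) (u : site) (s : seq site)
    : R :=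
  if s is v :: s' then
    (if diagonal_step u v then w v else 0) + path_weight w v s'
  else 0.

(* This supremum is a maximum as soon as v can be reached from u: see
   last_passage_max below. *)
Definition last_passage {R : realType} (w : site -> R) (u v : site) : R :=
  sup [set path_weight w u s | s in admissible_path u v].

Lemma finite_admissible_path (u v : site) : finite_set (admissible_path u v).
Proof.
suff H k : forall u, (v.1 + v.2 <= u.1 + u.2 + k)%N ->
    finite_set (admissible_path u v) by exact/(H (v.1 + v.2)%N)/leq_addl.
have le_last s : forall u, path admissible_step u s ->
    (u.1 + u.2 + size s <= (last u s).1 + (last u s).2)%N.
  elim: s => [|a s IH] b /=; first by rewrite addn0.
  case/andP => ba /IH; apply: leq_trans.
  rewrite addnS -addSn leq_add2r.
  by case/or3P: ba => /eqP -> /=; rewrite ?addSn ?addnS// ltnW.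
elim: k => [|k IH] {}u.
  rewrite addn0 => vu; apply: (@sub_finite_set _ _ [set [::]]) => //.
  case=> // a s [/le_last + lv]; rewrite lv => /leq_trans /(_ vu).
  by rewrite /= addnS -addSn => /(leq_trans (leq_addr _ _)); rewrite ltnn.
move=> vu; pose F a := [set a :: s | s in admissible_path a v].
apply: (@sub_finite_set _ _ ([set [::]] `|` (F (u.1.+1, u.2) `|`
    (F (u.1, u.2.+1) `|` F (u.1.+1, u.2.+1))))).
  case=> [|a s] /=; first by left.
  case=> /andP[ua ps] lv; right.
  by case/or3P: ua => /eqP E; [left|right; left|right; right]; exists s;
    rewrite -?E.
have finF a : (u.1 + u.2 < a.1 + a.2)%N -> finite_set (F a).
  move=> ua; apply/finite_image/IH; apply: (leq_trans vu).
  by rewrite addnS -addSn leq_add2r.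
rewrite !finite_setU; do !split => //; apply: finF => /=;
  by rewrite ?addSn ?addnS// ltnW.
Qed.

Lemma exists_admissible_path (u v : site) :
  (u.1 <= v.1)%N -> (u.2 <= v.2)%N -> admissible_path u v !=set0.
Proof.
case: u v => [a b] [c d] /= /subnKC <- /subnKC <-.
move: (c - a)%N (d - b)%N => {c d} k l; elim: k a => [|k IH] a.
  rewrite addn0; elim: l b => [|l IH] b.
    by rewrite addn0; exists [::].
  have [s [ps ls]] := IH b.+1; exists ((a, b.+1) :: s).
  by rewrite addnS -addSn; split => //=; rewrite ps /admissible_step eqxx orbT.
have [s [ps ls]] := IH a.+1; exists ((a.+1, b) :: s).
by rewrite addnS -addSn; split => //=; rewrite ps /admissible_step eqxx.
Qed.

Lemma last_passage_max {R : realType} (w : site -> R) (u v : site) :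
  (u.1 <= v.1)%N -> (u.2 <= v.2)%N ->
  (exists2 s, admissible_path u v s & path_weight w u s = last_passage w u v) /\
  (forall s, admissible_path u v s -> path_weight w u s <= last_passage w u v).
Proof.
move=> uv1 uv2; pose W := [set path_weight w u s | s in admissible_path u v].
have fin_max (A : set R) : finite_set A -> A !=set0 ->
    exists2 a, A a & ubound A a.
  case/finite_seqP => s -> {A}; elim: s => [|a s IH] [z //= _].
  have [-> |s0] := eqVneq s [::].
    by exists a => [|t] /=; rewrite inE // => /eqP ->.
  have [|b bs ub] := IH; first by case: (s) s0 => // t l _; exists t; exact: mem_head.
  exists (Num.max a b) => [|t] /=; rewrite inE.
    by rewrite /Order.max; case: ifP => _; rewrite ?eqxx ?bs ?orbT.
  by case/predU1P => [->|/ub tb]; rewrite le_max ?lexx// tb orbT.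
have [_ [s0 ps0 <-] ubW] : exists2 a, W a & ubound W a.
  apply: fin_max; first exact/finite_image/finite_admissible_path.
  by have [s ps] := exists_admissible_path uv1 uv2; exists (path_weight w u s), s.
have supE : last_passage w u v = path_weight w u s0.
  apply/eqP; rewrite eq_le; apply/andP; split.
    by apply: ge_sup ubW; exists (path_weight w u s0), s0.
  by apply: ub_le_sup; [exists (path_weight w u s0) | exists s0].
by rewrite supE; split => [|s ps]; [exists s0 | apply: ubW; exists s].
Qed.

(* Main.v *)
Require Import Defs.
From HB Require Import structures.
From mathcomp Require Import all_boot all_order all_algebra finmap.
From mathcomp Require Import all_classical all_reals all_analysis.
From mathcomp Require Import zify ring lra measurable_realfun.

Import Order.TTheory GRing.Theory Num.Theory.
Import numFieldNormedType.Exports.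

Local Open Scope classical_set_scope.
Local Open Scope ring_scope.

(** Off the cone the passage time is saturated: with overwhelming probability
    it equals its deterministic maximum.

    Suppose the target (m, n) is flat, [n < p m] up to a margin linear in N.
    Each diagonal step climbs one row and collects at most 1, so a path collects
    at most [n - 1] ([path_weight_le_height]).  Conversely, let a greedy path
    look at the site diagonally ahead, step there if its weight is 1, and
    otherwise move one column to the right ([greedy_path]).  This path inspects
    exactly one site in each new column, hence the bits it reads are i.i.d.
    Bernoulli, although the rows it visits are random.  If those [m - 1] bits
    contain at least [n - 1] ones, the greedy path reaches the top row with
    weight [n - 1] and then finishes horizontally, so that the passage time is
    exactly [n - 1] ([last_passage_greedy]).

    The number of ones is binomial with mean [p (m - 1)], which exceeds [n - 1]
    by an amount linear in N; Chernoff's bound makes the exceptional event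
    exponentially unlikely ([greedy_count_tail], [chernoff_rate]).  The law of
    the bits read is computed without conditional expectations: for a fixed bit
    vector the inspected sites are deterministic and distinct, so mutual
    independence gives the probability of reading that vector, and the union
    bound over bad bit vectors factorizes into the binomial generating function.
    Finally the variance is at most the second moment of the gap between
    [n - 1] and the passage time, hence at most [(n - 1)^2] times the
    probability of the exceptional event ([variance_le_gap]).

    The steep case follows by exchanging the two coordinates
    ([last_passage_swap]). *)

(** * Weights of paths *)

Lemma path_weight_rcons (R : realType) (w : site -> R) u s v :
  path_weight w u (rcons s v) =
  path_weight w u s + (if diagonal_step (last u s) v then w v else 0).
Proof.
elim: s u => [|a s IH] u /=; first by rewrite add0r addr0.
by rewrite IH addrA.
Qed.

Lemma path_weight_ge0 (R : realType) (w : site -> R) u s :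
  (forall v, 0 <= w v) -> 0 <= path_weight w u s.
Proof.
move=> w0; elim: s u => //= a s IH u.
by rewrite addr_ge0//; case: ifP.
Qed.

(** Weight is collected only on diagonal steps, and each of them climbs a
    row. *)
Lemma path_weight_le_height (R : realType) (w : site -> R) u s :
  (forall v, w v <= 1) -> path admissible_step u s ->
  u.2%:R + path_weight w u s <= (last u s).2%:R.
Proof.
move=> w1; elim: s u => [|a s IH] u /=; first by rewrite addr0.
case/andP => ua /IH; apply: le_trans; rewrite addrA lerD2r.
have [/eqP -> /=|nd] := boolP (diagonal_step u a).
  by rewrite -[u.2.+1%:R]natr1 lerD2l.
rewrite addr0 ler_nat.
by case/or3P: ua => /eqP -> //=; rewrite leqnSn.
Qed.

(** * Exchanging the coordinates *)

Definition swap_site (v : site) : site := (v.2, v.1).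

Lemma swap_siteK : involutive swap_site. Proof. by case. Qed.

Lemma diagonal_step_swap u v :
  diagonal_step (swap_site u) (swap_site v) = diagonal_step u v.
Proof. by rewrite /diagonal_step /swap_site /= !xpair_eqE andbC -xpair_eqE; case: v. Qed.

Lemma admissible_step_swap u v :
  admissible_step (swap_site u) (swap_site v) = admissible_step u v.
Proof.
rewrite /admissible_step diagonal_step_swap orbCA; case: u v => [a b] [c d].
by rewrite /swap_site /= !xpair_eqE; congr [|| _, _ | _]; exact: andbC.
Qed.

Lemma path_weight_swap (R : realType) (w : site -> R) u s :
  path_weight (w \o swap_site) (swap_site u) (map swap_site s) =
  path_weight w u s.
Proof.
by elim: s u => //= a s IH u; rewrite diagonal_step_swap swap_siteK IH.
Qed.

Lemma admissible_path_swap u v s :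
  admissible_path u v s ->
  admissible_path (swap_site u) (swap_site v) (map swap_site s).
Proof.
case=> us <-; split; last by rewrite last_map.
by rewrite path_map (eq_path (e' := admissible_step)) //; exact: admissible_step_swap.
Qed.

Lemma last_passage_swap (R : realType) (w : site -> R) u v :
  last_passage w u v =
  last_passage (w \o swap_site) (swap_site u) (swap_site v).
Proof.
congr sup; apply/seteqP; split => _ [s us <-].
  by exists (map swap_site s); [exact: admissible_path_swap | exact: path_weight_swap].
exists (map swap_site s).
  by rewrite -(swap_siteK u) -(swap_siteK v); exact: admissible_path_swap.
by rewrite -path_weight_swap (mapK swap_siteK).
Qed.

(** * The greedy path *)

(** The number of ones read by an explorer whose [i]-th query, after [a] ones,
    is answered by [g i a]. *)
Fixpoint greedy_count (g : nat -> nat -> bool) (k : nat) : nat :=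
  if k is k'.+1 then greedy_count g k' + g k' (greedy_count g k') else 0.

(** After [i] queries, [a] of them answered by 1, the greedy path stands at
    [(i + 1, a + 1)] and queries the site diagonally ahead. *)
Definition greedy_site (i a : nat) : site := (i.+2, a.+2).

(** The cap [h] is the number of rows left above the starting point: once it is
    reached the path has to stay in the top row. *)
Lemma greedy_path (R : realType) (w : site -> bool) (h k : nat) :
  let S := minn h (greedy_count (fun i a => w (greedy_site i a)) k) in
  exists2 s, admissible_path (1, 1)%N (k.+1, S.+1) s &
    path_weight (fun v => (w v)%:R : R) (1, 1)%N s = S%:R.
Proof.
elim: k => [|k]; first by exists [::]; rewrite /= minn0.
move=> /=; set c := greedy_count _ k => -[s [us ls] ws].
set b := w _; pose v : site := (k.+2, (minn h (c + b)).+1).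
have dv : diagonal_step (last (1, 1)%N s) v = (c < h)%N && b.
  rewrite ls /diagonal_step /v /= xpair_eqE eqxx /= eqSS.
  by case: b {v}; lia.
exists (rcons s v).
  split; last by rewrite last_rcons.
  rewrite rcons_path us /= /admissible_step dv ls /v /= xpair_eqE eqxx /= eqSS.
  by case: b {v dv}; lia.
rewrite path_weight_rcons ws dv.
have [/andP[ch bt]|nd] := boolP ((c < h)%N && b).
  (* As long as the cap is not reached, the site stepped into is the one that
     was queried. *)
  have -> : v = greedy_site k c by rewrite /v bt /greedy_site; congr (_, _); lia.
  by rewrite -/b -natrD; congr _%:R; rewrite bt; lia.
by rewrite addr0; congr _%:R; move: nd; case: (b); lia.
Qed.

Lemma last_passage_bounds (R : realType) (w : site -> bool) (m n : nat) :
  (0 < m)%N -> (0 < n)%N ->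
  0 <= last_passage (fun v => (w v)%:R : R) (1, 1)%N (m, n) <= n.-1%:R.
Proof.
move=> m0 n0; have [[s us <-] _] := @last_passage_max R (fun v => (w v)%:R)
  (1, 1)%N (m, n) m0 n0.
rewrite path_weight_ge0//=; case: us => us ls.
have := @path_weight_le_height R (fun v => (w v)%:R) _ _ (fun v => _) us.
rewrite ls /= -[in X in _ <= X](prednK n0) -[n.-1.+1%:R]natr1 addrC lerD2r.
by apply => v; case: (w v); rewrite ?ler01.
Qed.

Lemma last_passage_greedy (R : realType) (w : site -> bool) (m n : nat) :
  (0 < m)%N -> (0 < n)%N ->
  (n.-1 <= greedy_count (fun i a => w (greedy_site i a)) m.-1)%N ->
  last_passage (fun v => (w v)%:R : R) (1, 1)%N (m, n) = n.-1%:R.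
Proof.
move=> m0 n0 hc; apply/eqP; rewrite eq_le.
have /andP[_ ->]/= := @last_passage_bounds R w m n m0 n0.
have [s us ws] := @greedy_path R w n.-1 m.-1.
have [_ /(_ s)] := @last_passage_max R (fun v => (w v)%:R)
  (1, 1)%N (m, n) m0 n0.
by rewrite ws; move: us; rewrite (minn_idPl hc) !prednK// => us /(_ us).
Qed.
(** * Variance of a variable that is rarely below its maximum *)

Lemma bounded_Lfun2 (R : realType) (d : measure_display) (T : measurableType d)
    (P : probability T R) (X : T -> R) (M : R) :
  measurable_fun setT X -> (forall t, `|X t| <= M) -> X \in Lfun P 2%:E.
Proof.
move=> mX bX; rewrite inE /=; apply/andP; split; rewrite inE//=.
rewrite /finite_norm unlock poweR_lty//.
apply: integrable_lty => //.
have -> : (fun x => (`|(EFin \o X) x| `^ 2)%E) = EFin \o (fun t => X t ^+ 2).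
  by apply/funext => t /=; rewrite powR_mulrn// real_normK// num_real.
apply: measurable_bounded_integrable => //.
- by rewrite (le_lt_trans (probability_le1 P measurableT))// ltry.
- exact: measurable_funX.
- exists (M ^+ 2); split; first exact: num_real.
  move=> N MN t _ /=; apply: le_trans (ltW MN).
  by rewrite normrX ler_pXn2r// nnegrE// (le_trans _ (bX t)).
Qed.

(** The variance does not exceed the mean square distance to any constant, here
    to the maximal value [h]; that distance is at most [h], and zero off [U]. *)
Lemma variance_le_gap (R : realType) (d : measure_display) (T : measurableType d)
    (P : probability T R) (X : T -> R) (h : R) (U : set T) :
  measurable_fun setT X -> measurable U -> (forall t, 0 <= X t <= h) ->
  (forall t, ~ U t -> X t = h) -> ('V_P[X] <= (h ^+ 2)%:E * P U)%E.
Proof.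
move=> mX mU bX XU.
have X2 : X \in Lfun P 2%:E.
  apply: (@bounded_Lfun2 _ _ _ P X h) => // t.
  by have /andP[X0 Xh] := bX t; rewrite ger0_norm.
have Y2 : (cst h \- X) \in Lfun P 2%:E.
  apply: (@bounded_Lfun2 _ _ _ P _ h) => [|t /=]; first exact: measurable_funB.
  by have /andP[X0 Xh] := bX t; rewrite ger0_norm; lra.
rewrite -(varianceB_cst_l h X2) varianceE//.
have Y1 : (cst h \- X) \in Lfun P 1.
  by apply: Lfun_subset12 => //; exact: fin_num_measure.
have EYf := expectation_fin_num Y1.
apply: (@le_trans _ _ ('E_P[(cst h \- X) ^+ 2])%E).
  by rewrite -(fineK EYf) -EFin_expe leeBlDr// leeDl// lee_fin sqr_ge0.
have -> : (cst h \- X) ^+ 2 = (fun t => (h - X t) ^+ 2).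
  by apply/funext => t; rewrite fctE.
pose Z t : R := h ^+ 2 * \1_U t.
apply: (@le_trans _ _ ('E_P[Z])%E).
  apply: expectation_le.
  - by apply: measurable_funX; exact: measurable_funB.
  - by apply: measurable_funM => //; exact: measurable_indic.
  - by move=> t; exact: sqr_ge0.
  - by move=> t; rewrite mulr_ge0// sqr_ge0.
  - apply: aeW => t; rewrite /Z indicE; have [tU|/negP] := boolP (t \in U).
      have /andP[X0 Xh] := bX t.
      by rewrite mulr1 ler_pXn2r ?nnegrE //; lra.
    by rewrite inE => /XU ->; rewrite subrr mulr0 expr0n.
rewrite unlock; under eq_integral do rewrite EFinM.
rewrite ge0_integralZl//=; last by rewrite lee_fin sqr_ge0.
  by rewrite integral_indic// setIT.
by apply/measurable_EFinP; exact: measurable_indic.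
Qed.

(** * Large deviations of the greedy count *)

Lemma iid_bernoulli_cylinder (R : realType) (d : measure_display)
    (T : measurableType d) (P : probability T R) (p : R)
    (I : choiceType) (D : set I) (X : I -> {RV P >-> bool})
    (k : nat) (s : 'I_k -> I) (b : 'I_k -> bool) :
  0 <= p <= 1 -> iid_bernoulli p D X -> injective s -> (forall i, D (s i)) ->
  P (\bigcap_i (X (s i) @^-1` [set b i])) =
  (\prod_(i < k) (if b i then p else 1 - p))%:E.
Proof.
move=> p01 [indX lawX] s_inj Ds.
pose J := [fset s i | i in 'I_k]%fset.
(* [B] carries the prescribed values from indices to sites; injectivity of [s]
   makes [B (s i)] a singleton. *)
pose B v := [set c : bool | exists2 i, s i = v & c = b i].
have Bs i : B (s i) = [set b i].
  by apply/seteqP; split => c /=; [case=> j /s_inj -> | move=> ->; exists i].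
have JE : [set` J] = range s.
  apply/seteqP; split => v /=.
    by move=> /imfsetP[i _ ->]; exists i.
  by move=> [i _ <-]; apply/imfsetP; exists i.
have := indX J B; rewrite JE bigcap_image.
under eq_bigcapr do rewrite Bs.
move=> -> //; last by move=> v [i _ <-].
have PJ : perm_eq J [seq s i | i <- enum 'I_k].
  by apply: enum_imfset => i j _ _; exact: s_inj.
rewrite (perm_big _ PJ) big_map big_enum /= -prodEFin.
apply: eq_bigr => i _; rewrite Bs.
have /(congr1 (fun f => f [set b i])) := lawX _ (Ds i).
rewrite /distribution /pushforward => ->.
rewrite bernoulli_probE// !diracE; case: (b i).
  by rewrite mem_set// memNset// mule1 mule0 adde0.
by rewrite memNset// mem_set// mule0 mule1 add0e.
Qed.
(** Chernoff's bound for an adaptive explorer.  As queries with different indices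
    concern different variables whatever the answers were, each bit vector [b]
    is read with probability [prod_i q (b i)].  Each bad vector has fewer than
    [h] ones, so that the factor [exp (theta (h - ones))] is at least 1, and
    summing the product over all vectors yields the generating function of a
    binomial variable. *)
Lemma greedy_count_tail (R : realType) (d : measure_display)
    (T : measurableType d) (P : probability T R) (p : R)
    (I : choiceType) (D : set I) (X : I -> {RV P >-> bool})
    (f : nat -> nat -> I) (k h : nat) (theta : R) :
  0 <= p <= 1 -> iid_bernoulli p D X ->
  (forall i j a b, f i a = f j b -> i = j) -> (forall i a, D (f i a)) ->
  0 <= theta ->
  exists U : set T, [/\ measurable U,
    (P U <= (expR (theta * h%:R) *
             (1 - p + p * expR (- theta)) ^+ k)%:E)%E &
    forall t, ~ U t -> (h <= greedy_count (fun i a => X (f i a) t) k)%N].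
Proof.
move=> p01 iidX f_inj Df theta0; have /andP[p0 p1] := p01.
(* [level b i] is the number of ones among the first [i] bits of [b], that is,
   what the explorer knows at its [i]-th query; [ext] pads [b] with zeros so
   that [i] may range over all of nat. *)
pose ext (b : {ffun 'I_k -> bool}) j := oapp b false (insub j).
pose level b i := (\sum_(j < i) ext b j)%N.
have levelS b i : level b i.+1 = (level b i + ext b i)%N by rewrite /level big_ord_recr.
have extE b (i : 'I_k) : ext b i = b i by rewrite /ext valK.
pose cyl b := \bigcap_(i : 'I_k) (X (f i (level b i)) @^-1` [set b i]).
pose q c : R := if c then p else 1 - p.
have q0 c : 0 <= q c by rewrite /q; case: c; lra.
have cylP b : P (cyl b) = (\prod_i q (b i))%:E.
  apply: (@iid_bernoulli_cylinder _ _ _ P p I D X k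
    (fun i => f i (level b i)) b p01 iidX) => [i j /f_inj/val_inj//|i].
  exact: Df.
have mcyl b : measurable (cyl b).
  apply: fin_bigcap_measurable => // i _.
  by rewrite -[X in measurable X]setTI; exact: measurable_funP.
exists (\big[setU/set0]_(b : {ffun 'I_k -> bool} | (level b k < h)%N) cyl b).
split.
- exact: bigsetU_measurable.
- pose weight b : R := expR (theta * (h%:R - (level b k)%:R)) * \prod_i q (b i).
  have prod0 b : 0 <= \prod_i q (b i) by apply: prodr_ge0.
  apply: (@le_trans _ _ (\sum_(b | (level b k < h)%N) weight b)%:E).
    rewrite -sumEFin.
    have : forall r : seq {ffun 'I_k -> bool},
      measurable (\big[setU/set0]_(b <- r | (level b k < h)%N) cyl b) /\
      (P (\big[setU/set0]_(b <- r | (level b k < h)%N) cyl b) <=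
       \sum_(b <- r | (level b k < h)%N) (weight b)%:E)%E.
      elim=> [|b r [mU IH]]; first by rewrite !big_nil measure0.
      rewrite !big_cons; case: ifP => // bh; split; first exact: measurableU.
      apply: le_trans (measureU2 _ _ _) _ => //; apply: leeD => //.
      have /eqP := cylP b; rewrite eq_le => /andP[/le_trans + _]; apply.
      rewrite lee_fin /weight ler_peMl// -[leLHS]expR0 ler_expR.
      by rewrite mulr_ge0// subr_ge0 ler_nat ltnW.
    by move=> /(_ (index_enum _))[].
  rewrite lee_fin; apply: (@le_trans _ _ (\sum_b weight b)).
    rewrite big_mkcond; apply: ler_sum => b _; case: ifP => // _.
    by rewrite /weight mulr_ge0// expR_ge0.
  have weightE b : weight b =
      expR (theta * h%:R) * \prod_i (q (b i) * expR (- theta * (b i)%:R)).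
    rewrite /weight mulrBr expRD -mulrA; congr (_ * _).
    rewrite big_split /= mulrC; congr (_ * _).
    rewrite -expR_sum -mulr_sumr -natr_sum mulNr; congr (expR (- (_ * _%:R))).
    by rewrite /level; apply: eq_bigr => i _; rewrite extE.
  rewrite (eq_bigr _ (fun b _ => weightE b)) -mulr_sumr.
  (* The sum over all bit vectors factorizes over the positions. *)
  rewrite -(bigA_distr_bigA (fun=> fun c : bool => q c * expR (- theta * c%:R))).
  rewrite prodr_const card_ord big_bool /= mulr1 mulr0 expR0 mulr1.
  by rewrite /q addrC.
- move=> t; apply: contra_notT; rewrite -ltnNge => ch.
  (* A bad outcome lies in the cylinder of the bits that it actually reads. *)
  set g := (fun i a => X (f i a) t) in ch *.
  pose b := [ffun i : 'I_k => g i (greedy_count g i)].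
  have lE i : (i <= k)%N -> level b i = greedy_count g i.
    elim: i => [|i IH] ik; first by rewrite /level big_ord0.
    rewrite levelS /= IH 1?ltnW//; congr (_ + nat_of_bool _)%N.
    by rewrite (extE b (Ordinal ik)) ffunE.
  rewrite (bigD1 b) /=; last by rewrite lE.
  left => i _ /=; rewrite lE; last exact/ltnW.
  by rewrite ffunE.
Qed.

(** * Variance of the passage time to a given site *)

Lemma measurable_path_weight (R : realType) (d : measure_display)
    (T : measurableType d) (w : site -> T -> R) u s :
  (forall v, measurable_fun setT (w v)) ->
  measurable_fun setT (fun t => path_weight (w ^~ t) u s).
Proof.
move=> mw; elim: s u => [|v s IH] u /=; first exact: measurable_cst.
apply: measurable_funD; last exact: IH.
by case: (diagonal_step u v).
Qed.

Lemma measurable_last_passage (R : realType) (d : measure_display)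
    (T : measurableType d) (w : site -> T -> R) (u v : site) :
  (u.1 <= v.1)%N -> (u.2 <= v.2)%N ->
  (forall v, measurable_fun setT (w v)) ->
  measurable_fun setT (fun t => last_passage (w ^~ t) u v).
Proof.
move=> uv1 uv2 mw mT; apply: (measurability _ (RGenOInfty.measurableE R)) => //.
move=> _ [_ [a ->] <-]; rewrite setTI.
rewrite (_ : _ @^-1` _ = \bigcup_(s in admissible_path u v)
    ((fun t => path_weight (w ^~ t) u s) @^-1` `]a, +oo[)).
  apply: fin_bigcup_measurable; first exact: finite_admissible_path.
  move=> s _; rewrite -[X in measurable X]setTI.
  by apply: measurable_path_weight => //; exact: measurable_itv.
apply/seteqP; split => t /=; rewrite in_itv /= andbT.
  have [[s us <-] _] := @last_passage_max R (w ^~ t) u v uv1 uv2.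
  by exists s => //=; rewrite in_itv /= andbT.
case=> s us /=; rewrite in_itv /= andbT => /lt_le_trans; apply.
by have [_ ] := @last_passage_max R (w ^~ t) u v uv1 uv2; exact.
Qed.

(** The relabelling [phi] is the identity for flat targets and the exchange of
    the coordinates for steep ones. *)
Lemma variance_last_passage_le (R : realType) (d : measure_display)
    (T : measurableType d) (P : probability T R) (p : R)
    (omega : site -> {RV P >-> bool}) (phi : site -> site) (m n : nat)
    (theta : R) :
  0 <= p <= 1 -> iid_bernoulli p positive_sites omega ->
  injective phi -> (forall v, positive_sites v -> positive_sites (phi v)) ->
  (0 < m)%N -> (0 < n)%N -> 0 <= theta ->
  ('V_P[fun t => last_passage (fun v => (omega (phi v) t)%:R) (1, 1)%N (m, n)]
   <= (n.-1%:R ^+ 2 * (expR (theta * n.-1%:R) *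
        (1 - p + p * expR (- theta)) ^+ m.-1))%:E)%E.
Proof.
move=> p01 iid phi_inj phi_pos m0 n0 theta0.
have [U [mU PU hU]] := @greedy_count_tail R d T P p _ positive_sites omega
  (fun i a => phi (greedy_site i a)) m.-1 n.-1 theta p01 iid
  (fun i j a b e => ltac:(by case: (phi_inj _ _ e)))
  (fun i a => phi_pos (greedy_site i a) (conj isT isT)) theta0.
rewrite EFinM; apply: (@le_trans _ _ ((n.-1%:R ^+ 2)%:E * P U)%E); last first.
  by apply: lee_wpmul2l => //; rewrite lee_fin sqr_ge0.
apply: variance_le_gap => //.
- apply: (@measurable_last_passage R d T
    (fun v t => (omega (phi v) t)%:R)) => // v.
  by apply: (measurableT_comp (f := fun b : bool => b%:R : R)).
- by move=> t; exact: last_passage_bounds.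
- by move=> t /hU; exact: last_passage_greedy.
Qed.

(** * Exponential rate off the cone *)

(** Since [1 - t <= exp (- t)], the Chernoff factor is at most
    [exp (theta (n - 1) - u (m - 1))] with [u = p (1 - exp (- theta))], which is
    of order [exp (- (u a - theta b) N)].  To first order in [theta] the rate
    [u a - theta b] is [theta (p a - b)], so it is positive for small
    [theta]. *)
Lemma chernoff_rate (R : realType) (p a b : R) :
  0 < p -> p < 1 -> 0 < a -> 0 < b -> b < p * a ->
  exists theta c C : R, [/\ 0 <= theta, 0 < c, 0 < C &
    forall N : nat,
      let m := Num.truncn (N%:R * a) in let n := Num.truncn (N%:R * b) in
      (0 < m)%N -> (0 < n)%N ->
      n.-1%:R ^+ 2 * (expR (theta * n.-1%:R) *
        (1 - p + p * expR (- theta)) ^+ m.-1) <=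
      C * N%:R ^+ 2 * expR (- c * N%:R)].
Proof.
move=> p0 p1 a0 b0 bpa.
(* From [u >= p theta / (1 + theta)], the rate is positive as soon as
   [1 + theta < p a / b]; this choice makes [1 + theta] the midpoint of 1 and
   [p a / b]. *)
pose theta := (p * a - b) / (2 * b).
have theta0 : 0 < theta by rewrite divr_gt0; lra.
pose u := p * (1 - expR (- theta)).
have expN : expR (- theta) <= (1 + theta)^-1.
  rewrite expRN lef_pV2 ?posrE ?expR_gt0//; last lra.
  exact: expR_ge1Dx.
have e0 := expR_gt0 (- theta).
have u_le : p * theta / (1 + theta) <= u.
  rewrite /u -mulrA; apply: ler_wpM2l; first exact: ltW.
  have -> : theta / (1 + theta) = 1 - (1 + theta)^-1 by field; lra.
  lra.
pose c := u * a - theta * b.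
have c0 : 0 < c.
  rewrite subr_gt0; apply: lt_le_trans (ler_wpM2r (ltW a0) u_le).
  have -> : p * theta / (1 + theta) * a = theta * (p * a / (1 + theta)).
    by field; lra.
  rewrite ltr_pM2l// ltr_pdivlMr; last lra.
  have -> : b * (1 + theta) = (p * a + b) / 2 by rewrite /theta; field; lra.
  lra.
(* The factor [exp (2 u)] absorbs the loss in [m - 1 >= N a - 2]. *)
exists theta, c, (b ^+ 2 * expR (2 * u)); split => //.
- exact: ltW.
- by rewrite mulr_gt0 ?expR_gt0// exprn_gt0.
move=> N m n m0 n0.
have Na0 : 0 <= N%:R * a by rewrite mulr_ge0 // ltW.
have Nb0 : 0 <= N%:R * b by rewrite mulr_ge0 // ltW.
have /andP[_ m_gt] := truncn_itv Na0; have /andP[n_le _] := truncn_itv Nb0.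
rewrite -/m -natr1 in m_gt; rewrite -/n in n_le.
have mE : m.-1%:R = m%:R - 1 :> R by rewrite -[in RHS](prednK m0) -natr1 addrK.
have nE : n.-1%:R = n%:R - 1 :> R by rewrite -[in RHS](prednK n0) -natr1 addrK.
have u0 : 0 <= u by rewrite (le_trans _ u_le)// !mulr_ge0// ?invr_ge0; lra.
rewrite [leRHS](_ : _ = (N%:R * b) ^+ 2 * (expR (2 * u) * expR (- c * N%:R))).
  2: by ring.
rewrite ler_pM ?sqr_ge0//.
- rewrite mulr_ge0 ?expR_ge0// exprn_ge0// addr_ge0 ?mulr_ge0//; lra.
- by rewrite ler_pXn2r ?nnegrE//; lra.
apply: (@le_trans _ _ (expR (theta * n.-1%:R) * expR (- u * m.-1%:R))).
  rewrite ler_wpM2l ?expR_ge0// expRM_natr.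
  rewrite lerXn2r ?nnegrE ?expR_ge0//.
    by rewrite addr_ge0 ?mulr_ge0//; lra.
  by apply: le_trans (expR_ge1Dx _); rewrite /u; lra.
rewrite -!expRD ler_expR mE nE.
have h1 : theta * (n%:R - 1) <= theta * (N%:R * b).
  by apply: ler_wpM2l; [exact: ltW | lra].
have h2 : u * (N%:R * a - 2) <= u * (m%:R - 1) by apply: ler_wpM2l => //; lra.
rewrite /c; lra.
Qed.

(** Cubing [exp z >= z] at [z = c N / 3] shows that [exp (c N)] grows at least
    like [N^3], which beats [N^2]; the bound is compared with [1 / (N + 1)]
    rather than [1 / N] to match the harmonic sequence, at the cost of a
    factor 2. *)
Lemma cvg_sqr_expR (R : realType) (c C : R) : 0 < c -> 0 < C ->
  C * N%:R ^+ 2 * expR (- c * N%:R) @[N --> \oo] --> 0.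
Proof.
move=> c0 C0; pose K := 54 * C / c ^+ 3.
have c3 : 0 < c ^+ 3 by rewrite exprn_gt0.
have KH : K *: @harmonic R N @[N --> \oo] --> 0.
  by rewrite -(scaler0 _ K); apply: cvgZr; exact: cvg_harmonic.
apply: (squeeze_cvgr _ (cvg_cst 0) KH); exists 1%N => // N /= N1.
rewrite !mulr_ge0 ?expR_ge0 ?(ltW C0)//=.
have NR : 1 <= N%:R :> R by rewrite ler1n.
have cN : 0 < c * N%:R / 3 by rewrite divr_gt0// mulr_gt0//; lra.
have e3 : (c * N%:R / 3) ^+ 3 <= expR (c * N%:R).
  have -> : c * N%:R = c * N%:R / 3 * 3%:R by field.
  rewrite expRM_natr lerXn2r ?nnegrE ?expR_ge0 ?ltW//.
    by rewrite mulfK// .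
  by apply: lt_le_trans (expR_ge1Dx _); rewrite mulfK//; lra.
rewrite mulNr expRN.
apply: (@le_trans _ _ (C * N%:R ^+ 2 * ((c * N%:R / 3) ^+ 3)^-1)).
  rewrite ler_wpM2l ?mulr_ge0 ?(ltW C0)// lef_pV2 ?posrE ?expR_gt0//.
  by rewrite exprn_gt0.
rewrite /K /harmonic /= /GRing.scale /= -[N.+1%:R]natr1.
have -> : C * N%:R ^+ 2 * ((c * N%:R / 3) ^+ 3)^-1 = 27 * C / c ^+ 3 * N%:R^-1.
  by field; lra.
have -> : 54 * C / c ^+ 3 * (N%:R + 1)^-1 = 27 * C / c ^+ 3 * (2 * (N%:R + 1)^-1).
  by field; lra.
apply: ler_wpM2l; first by rewrite divr_ge0 ?mulr_ge0 ?ltW.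
clear -NR; rewrite ler_pdivlMr; last lra.
rewrite mulrC ler_pdivrMr; last lra.
lra.
Qed.

(** * Exponential decay of the variance *)

Lemma variance_decay (R : realType) (p x y : R) :
  0 < p -> p < 1 -> 0 < x -> 0 < y -> (y / x < p \/ p^-1 < y / x) ->
  exists c C : R, [/\ 0 < c, 0 < C &
    forall (d : measure_display) (T : measurableType d) (P : probability T R)
        (omega : site -> {RV P >-> bool}),
      iid_bernoulli p positive_sites omega ->
      forall N : nat,
        let m := Num.truncn (N%:R * x) in let n := Num.truncn (N%:R * y) in
        (0 < m)%N -> (0 < n)%N ->
        ('V_P[fun t => last_passage (fun v => (omega v t)%:R) (1, 1)%N (m, n)]
         <= (C * N%:R ^+ 2 * expR (- c * N%:R))%:E)%E].
Proof.
move=> p0 p1 x0 y0 off; have p01 : 0 <= p <= 1 by rewrite !ltW.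
case: off => slope.
  have ypx : y < p * x by rewrite -ltr_pdivrMr.
  have [theta [c [C [th0 c0 C0 rate]]]] := chernoff_rate _ _ _ _ p0 p1 x0 y0 ypx.
  exists c, C; split => // d T P omega iid N m n m0 n0.
  apply: (@le_trans _ _ _ _ _ (@variance_last_passage_le R d T P p omega id
    m n theta p01 iid (fun _ _ => id) (fun _ => id) m0 n0 th0)).
  by rewrite lee_fin; exact: rate.
have xpy : x < p * y.
  by move: slope; rewrite ltr_pdivlMr// mulrC ltr_pdivrMr// mulrC.
have [theta [c [C [th0 c0 C0 rate]]]] := chernoff_rate _ _ _ _ p0 p1 y0 x0 xpy.
exists c, C; split => // d T P omega iid N m n m0 n0.
under [X in ('V_P[X])%E]eq_fun do rewrite last_passage_swap.
have swap_pos v : positive_sites v -> positive_sites (swap_site v) by case.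
apply: (@le_trans _ _ _ _ _ (@variance_last_passage_le R d T P p omega swap_site
  n m theta p01 iid (inv_inj swap_siteK) swap_pos n0 m0 th0)).
by rewrite lee_fin; exact: rate.
Qed.

Theorem theorem2p7 (R : realType) (p x y : R)
    (p_gt0 : 0 < p) (p_lt1 : p < 1) (x_gt0 : 0 < x) (y_gt0 : 0 < y)
    (off_cone : y / x < p \/ p^-1 < y / x) :
  exists c C : R, 0 < c /\ 0 < C /\
    forall (d : measure_display) (T : measurableType d) (P : probability T R)
        (omega : site -> {RV P >-> bool}),
      iid_bernoulli p positive_sites omega ->
      let G (m n : nat) : T -> R :=
        fun t => last_passage (fun v => (omega v t)%:R) (1%N, 1%N) (m, n) in
      let VarG (N : nat) : \bar R :=
        ('V_P[G (Num.truncn (N%:R * x)) (Num.truncn (N%:R * y))])%E in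
      (forall N : nat,
        (1 <= Num.truncn (N%:R * x))%N -> (1 <= Num.truncn (N%:R * y))%N ->
        (VarG N <= (C * N%:R ^+ 2 * expR (- c * N%:R))%:E)%E) /\
      (VarG N @[N --> \oo] --> 0%E).
Proof.
have [c [C [c0 C0 bound]]] := variance_decay _ _ _ _ p_gt0 p_lt1 x_gt0 y_gt0 off_cone.
exists c, C; do 2 split => //; move=> d T P omega iid G VarG.
split; first exact: bound.
have majorant0 : (C * N%:R ^+ 2 * expR (- c * N%:R))%:E @[N --> \oo] --> 0%E.
  by apply: cvg_EFin; [exact: nearW | exact: (cvg_sqr_expR _ _ _ c0 C0)].
apply: (squeeze_cvge _ (cvg_cst 0%E) majorant0).
near=> N; rewrite variance_ge0 /=; apply: bound => //; rewrite truncn_gt0.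
- rewrite -ler_pdivrMr// mul1r; near: N; exact: nbhs_infty_ger.
- rewrite -ler_pdivrMr// mul1r; near: N; exact: nbhs_infty_ger.
Unshelve. all: by end_near.
Qed.
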